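(* Let $X=\{(x_1,t_1),(x_2,t_2),\dots,(x_n,t_n)\}$ be a finite subset of $\mathbb{R}\times\mathbb{R}^{*+}$. Then there exists a finite subset $R$ of $\mathbb{R}^{*+}$ such that for all real $\varepsilon>0$ there exists $r\in R$ such that, if $0<\varepsilon\le r$, then there exist rational numbers $\left(\frac{p_i}{q}\right)_{i=1,2,\dots,n}$ (with a common denominator $q$) such that for every $i=1,2,\dots,n$: $$\left|x_i-\frac{p_i}{q}\right|\le \varepsilon t_i\quad\text{and}\quad \varepsilon q\le t_i .$$
   Context: $\mathbb{R}^{*+}$ denotes the set of strictly positive real numbers. In the family $\left(\frac{p_i}{q}\right)_{i}$ the $p_i$ are integers and $q$ is a positive integer, the same for all $i$. *)

(* Defs.v *)
From HB Require Import structures.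
From mathcomp Require Import all_boot all_order all_algebra.
From mathcomp Require Import all_classical all_reals.

(* Main.v *)
Require Import Defs.
From HB Require Import structures.
From mathcomp Require Import all_boot all_order all_algebra.
From mathcomp Require Import all_classical all_reals.
From mathcomp Require Import lra.

(** The Dirichlet approximation theorem is not sharp enough here: it may return
    a small denominator [q], for which its error bound [1 / (q Q^(1/n))] exceeds
    the allowed [O(1 / Q)].  Instead, [q] is taken close to the largest
    denominator [Q ~ tau / eps] that the second inequality permits, with [tau]
    a positive lower bound of the [t i].  For such a [q] the first inequality only asks
    that every [q * x i] be within a constant distance, about [tau ^ 2 / 2], of
    an integer.

    Such denominators exist near every [Q] because the return times of the
    translation by [x] on the torus to a neighbourhood of the origin have
    bounded gaps ([toral_return_bounded_gaps]).  Cut the torus into finitely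
    many small cells; each cell visited by the orbit of the origin is visited
    before some time [L] ([finite_range_attained_early]).  So [Q * x] shares its
    cell with [m * x] for some [m <= L], and [q = Q - m] is a return time within
    [L] of [Q].  As soon as [eps] is small with respect to [L], this [q] exceeds
    [tau / (2 eps)].  Hence a single threshold [r] serves for all [eps]. *)

Set Implicit Arguments.
Unset Strict Implicit.
Unset Printing Implicit Defensive.

Import Order.TTheory GRing.Theory Num.Theory.
Local Open Scope classical_set_scope.
Local Open Scope ring_scope.

Lemma finite_range_attained_early (T : finType) (f : nat -> T) :
  exists L : nat, forall k, exists2 m, (m <= L)%N & f m = f k.
Proof.
have early c : exists m, forall k, f k = c -> f m = c.
  have [[m fm]|none] := pselect (exists m, f m = c); first by exists m.
  by exists 0%N => k fk; case: none; exists k.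
have [g gP] := choice early.
exists (\max_c g c)%N => k; exists (g (f k)); last exact: gP.
exact: leq_bigmax.
Qed.

Lemma dist_lt1_truncn (R : archiRealFieldType) (a b : R) :
  0 <= a -> 0 <= b -> Num.truncn a = Num.truncn b -> `|a - b| < 1.
Proof.
move=> a0 b0 ab.
have /andP[] := truncn_itv a0; have /andP[] := truncn_itv b0.
rewrite ab -natr1 => *; rewrite ltr_norml; lra.
Qed.

(** The cell of a point of the torus is read off by truncating [N] times the
    fractional parts of its coordinates; two times [k] and [m] with the same
    cell differ by a time at which the orbit is [1 / N]-close to the origin. *)
Lemma toral_return_bounded_gaps (R : archiRealFieldType) (n N : nat)
    (x : 'I_n -> R) :
  exists L : nat, forall k : nat, exists2 m : nat, (m <= L)%N &
    exists p : 'I_n -> int,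
      forall i, N%:R * `|(k%:R - m%:R) * x i - (p i)%:~R| < 1.
Proof.
pose frac (y : R) := y - (Num.floor y)%:~R.
have frac_ge0 y : 0 <= frac y by rewrite subr_ge0 floor_le.
have frac_lt1 y : frac y < 1.
  by rewrite ltrBlDr addrC -[1]/(1%:~R) -intrD floorD1_gt.
have Nfrac_ge0 y : 0 <= N%:R * frac y by rewrite mulr_ge0.
have box_lt y : (Num.truncn (N%:R * frac y) < N.+1)%N.
  rewrite truncn_lt_nat // -natr1.
  have := ler_wpM2l (ler0n R N) (ltW (frac_lt1 y)); lra.
pose cell (k : nat) : {ffun 'I_n -> 'I_N.+1} :=
  [ffun i => inord (Num.truncn (N%:R * frac (k%:R * x i)))].
have [L early] := finite_range_attained_early cell.
exists L => k; have [m mL cellE] := early k; exists m => //.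
exists (fun i => Num.floor (k%:R * x i) - Num.floor (m%:R * x i)) => i.
have /(congr1 val) := congr1 (fun c : {ffun 'I_n -> 'I_N.+1} => c i) cellE.
rewrite /= !ffunE !inordK // => /esym truncE.
have := dist_lt1_truncn (Nfrac_ge0 _) (Nfrac_ge0 _) truncE.
rewrite -mulrBr normrM normr_nat.
suff -> : frac (k%:R * x i) - frac (m%:R * x i) = (k%:R - m%:R) * x i -
    (Num.floor (k%:R * x i) - Num.floor (m%:R * x i))%:~R by [].
rewrite /frac intrB; lra.
Qed.

Theorem theorem1p3 (R : realType) (n : nat) (x t : 'I_n -> R)
    (t_gt0 : forall i : 'I_n, 0 < t i) :
  exists S : set R,
    finite_set S /\
    S `<=` [set r : R | 0 < r] /\
    forall eps : R, 0 < eps ->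
      exists r : R, S r /\
        (0 < eps <= r ->
         exists (p : 'I_n -> int) (q : int),
           0 < q /\
           forall i : 'I_n,
             `|x i - (p i)%:~R / q%:~R| <= eps * t i /\
             eps * q%:~R <= t i).
Proof.
have [tau tau_gt0 tau_le] : exists2 tau : R, 0 < tau & forall i, tau <= t i.
  exists (\big[Num.min/1]_i t i) => [|i]; last exact: bigmin_le_cond.
  by apply/bigmin_gtP; split.
pose N := (Num.truncn (2 / tau ^+ 2)).+1.
have N_big : 2 <= N%:R * tau ^+ 2.
  by rewrite -ler_pdivrMr ?exprn_gt0 // ltW // truncnS_gt.
have [L gaps] := toral_return_bounded_gaps N x.
pose r := tau / (2 * L.+1%:R).
have r_gt0 : 0 < r by rewrite divr_gt0 // mulr_gt0.
exists [set r]; split; first exact: finite_set1.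
split=> [_ -> //|eps eps_gt0]; exists r; split=> // /andP[_ eps_le_r].
have eps_small : eps * (2 * L.+1%:R) <= tau by rewrite -ler_pdivlMr // mulr_gt0.
pose Q := Num.truncn (tau / eps).
have [Q_le Q_gt] : eps * Q%:R <= tau /\ tau < eps * Q.+1%:R.
  have /andP[lo hi] := truncn_itv (divr_ge0 (ltW tau_gt0) (ltW eps_gt0)).
  by rewrite ![eps * _]mulrC -ler_pdivlMr // -ltr_pdivrMr.
have [m mL [p close]] := gaps Q.
pose q : int := Q%:Z - m%:Z.
have qE : q%:~R = Q%:R - m%:R :> R by rewrite intrB.
have eps_q_le : eps * q%:~R <= tau.
  have : 0 <= eps * m%:R by rewrite mulr_ge0 // ltW.
  rewrite qE mulrBr; lra.
(* The point of the threshold r: giving up at most L units of Q still leaves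
   more than half of the largest admissible denominator. *)
have eps_q_gt : tau < 2 * (eps * q%:~R).
  have : eps * m%:R <= eps * L%:R by rewrite ler_pM2l // ler_nat.
  move: eps_small Q_gt; rewrite qE -!natr1; nra.
have q_gt0 : 0 < q%:~R :> R by rewrite -(pmulr_rgt0 _ eps_gt0); lra.
exists p, q; split=> [|i]; first by rewrite ltr0z in q_gt0.
split; last exact: le_trans eps_q_le (tau_le i).
apply: (@le_trans _ _ (eps * tau)); last by rewrite ler_pM2l.
have -> : x i - (p i)%:~R / q%:~R = (q%:~R * x i - (p i)%:~R) / q%:~R.
  by rewrite mulrBl mulrAC divff ?mul1r ?gt_eqF.
rewrite normrM normfV (gtr0_norm q_gt0) ler_pdivrMr //.
have := close i; rewrite -qE; set d := `|_| => Nd_lt1.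
have N_gt0 : 0 < N%:R :> R by rewrite ltr0n.
(* Both sides are compared after multiplication by N:
   N d < 1 <= N tau^2 / 2 < N tau (eps q). *)
rewrite -(ler_pM2l N_gt0); apply: (le_trans (ltW Nd_lt1)).
have : 0 <= N%:R * tau * (2 * (eps * q%:~R) - tau).
  by rewrite !mulr_ge0 ?subr_ge0 // ltW.
move: N_big; lra.
Qed.
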